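(* Let $\boldsymbol{A}$ be a symmetric positive semidefinite matrix with the spectral notation of the context, and let $\boldsymbol{x}_0\in\mathbb{R}^n$ satisfy $\mathcal{P}_{\mathcal{Q}_1}(\boldsymbol{x}_0)\neq\boldsymbol{0}$, where $\mathcal{Q}_1$ is the dominant eigenspace of $\boldsymbol{A}$. Let $\boldsymbol{q}_1=\mathcal{P}_{\mathcal{Q}_1}(\boldsymbol{x}_0)/\|\mathcal{P}_{\mathcal{Q}_1}(\boldsymbol{x}_0)\|$. Then the sequence $\{\boldsymbol{x}_k\}$ generated by the Split-Merge algorithm (defined in the context) from $\boldsymbol{x}_0$ converges to a global minimizer of $f(\boldsymbol{x})=\|\boldsymbol{x}\|^2-(\boldsymbol{x}^T\boldsymbol{A}\boldsymbol{x})^{1/2}$ on $\mathbb{R}^n$, and $$\lim_{k\to\infty}\boldsymbol{x}_k=\frac{\sqrt{\lambda_1}}{2}\,\boldsymbol{q}_1.$$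
   Context: Spectral notation: $\boldsymbol{A}\in\mathbb{R}^{n\times n}$ is symmetric positive semidefinite of rank $r$, $\boldsymbol{A}=\boldsymbol{Q}\operatorname{diag}(\lambda_1,\dots,\lambda_n)\boldsymbol{Q}^T$ with $\boldsymbol{Q}=[\boldsymbol{q}_1,\dots,\boldsymbol{q}_n]$ orthogonal, with positive eigenvalues ordered as $\lambda_1=\dots=\lambda_{m_1}>\lambda_{m_1+1}=\dots=\lambda_{m_2}>\lambda_{m_2+1}\ge\dots\ge\lambda_r>0$ and the remaining $n-r$ eigenvalues equal to zero; $m_1$ and $m_2-m_1$ are the multiplicities of the two largest distinct eigenvalues. $\mathcal{Q}_1=\operatorname{span}\{\boldsymbol{q}_1,\dots,\boldsymbol{q}_{m_1}\}$, $\mathcal{P}_{\mathcal{Q}_1}$ is the orthogonal projection onto $\mathcal{Q}_1$, $\|\cdot\|$ is the Euclidean norm, and the orthonormal basis of $\mathcal{Q}_1$ is chosen so that its first vector is $\boldsymbol{q}_1=\mathcal{P}_{\mathcal{Q}_1}(\boldsymbol{x}_0)/\|\mathcal{P}_{\mathcal{Q}_1}(\boldsymbol{x}_0)\|$. Split-Merge algorithm: fix a safeguard $\epsilon_\sigma\in(0,1)$. Given $\boldsymbol{x}_k$, set $\mu_k=2(\boldsymbol{x}_k^T\boldsymbol{A}\boldsymbol{x}_k)^{1/2}$, $\alpha_k=\dfrac{\boldsymbol{x}_k^T\boldsymbol{A}^2\boldsymbol{x}_k}{\boldsymbol{x}_k^T\boldsymbol{A}\boldsymbol{x}_k}$, $\boldsymbol{r}_k=\boldsymbol{A}^2\boldsymbol{x}_k-\alpha_k\boldsymbol{A}\boldsymbol{x}_k$,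 $\gamma_k=\dfrac{\|\boldsymbol{r}_k\|^2}{(\boldsymbol{A}\boldsymbol{x}_k)^T\boldsymbol{r}_k}$, $\rho_k=\max\left\{1,\dfrac{\alpha_k}{\mu_k},\dfrac{\gamma_k}{\mu_k(1-\epsilon_\sigma)}\right\}$, $\sigma_k=1-\dfrac{\gamma_k}{\rho_k\mu_k}$, $\zeta_k=\dfrac1{\mu_k}-\dfrac{\alpha_k}{\mu_k^2\sigma_k\rho_k}$, $\omega_k=\dfrac1{\mu_k^2\sigma_k\rho_k}$, and update $\boldsymbol{x}_{k+1}=\zeta_k\boldsymbol{A}\boldsymbol{x}_k+\omega_k\boldsymbol{A}^2\boldsymbol{x}_k$. The algorithm stops only if $\boldsymbol{r}_k=\boldsymbol{0}$; the statement concerns an infinite sequence, i.e. $\boldsymbol{r}_k\neq\boldsymbol{0}$ for all $k$. *)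

(* Defs.v *)
From HB Require Import structures.
From mathcomp Require Import all_boot all_order all_algebra.
From mathcomp Require Import all_classical all_reals all_analysis.
Set Implicit Arguments.
Unset Strict Implicit.
Unset Printing Implicit Defensive.
Import Order.TTheory GRing.Theory Num.Theory numFieldNormedType.Exports.
Local Open Scope classical_set_scope.
Local Open Scope ring_scope.

Definition dot (R : realType) (n : nat) (u v : 'cV[R]_n) : R :=
  (u^T *m v) ord0 ord0.

                                                                              
                                                                           
Definition enorm (R : realType) (n : nat) (x : 'cV[R]_n) : R :=
  Num.sqrt (dot x x).

                                                                         
                                                                         
                                                                       
Record spectral (R : realType) (n : nat) (A Q : 'M[R]_n.+1)
    (lam : 'rV[R]_n.+1) (m1 m2 : nat) : Prop := Spectral {
  spectral_sym : A^T = A;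
  spectral_psd : forall x : 'cV[R]_n.+1, 0 <= dot x (A *m x);
  spectral_orthogonal : Q^T *m Q = 1%:M;
  spectral_decomposition : A = Q *m diag_mx lam *m Q^T;
  spectral_nonincreasing : forall i j : 'I_n.+1,
    (i <= j)%N -> lam ord0 j <= lam ord0 i;
  spectral_pos : forall i : 'I_n.+1, (i < \rank A)%N -> 0 < lam ord0 i;
  spectral_zero : forall i : 'I_n.+1, (\rank A <= i)%N -> lam ord0 i = 0;
  spectral_mult : (0 < m1 <= m2)%N /\ (m2 <= \rank A)%N;
  spectral_mult2 : (m1 < \rank A)%N -> (m1 < m2)%N;
  spectral_first_block : forall i : 'I_n.+1,
    (i < m1)%N = (lam ord0 i == lam ord0 ord0);
  spectral_second_block : forall i j : 'I_n.+1,
    (m1 <= i < m2)%N -> (m1 <= j)%N ->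
    (j < m2)%N = (lam ord0 j == lam ord0 i)
}.

                                            
Definition dominant_space (R : realType) (n : nat) (Q : 'M[R]_n.+1)
    (m1 : nat) : 'M[R]_n.+1 :=
  (\sum_(i < n.+1 | (i < m1)%N) <<(col i Q)^T>>)%MS.

                                                                             
                                                                      
Definition orthproj (R : realType) (n : nat) (U : 'M[R]_n) (x : 'cV[R]_n) :
    'cV[R]_n :=
  (x^T *m proj_mx U (kermx U^T))^T.

Section SplitMerge.
Variables (R : realType) (n : nat) (A : 'M[R]_n) (eps : R).
Implicit Type x : 'cV[R]_n.

Definition sm_mu x : R := 2 * Num.sqrt (dot x (A *m x)).

Definition sm_alpha x : R := dot x (A *m A *m x) / dot x (A *m x).

Definition sm_residual x : 'cV[R]_n :=
  A *m A *m x - sm_alpha x *: (A *m x).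

Definition sm_gamma x : R :=
  enorm (sm_residual x) ^+ 2 / dot (A *m x) (sm_residual x).

Definition sm_rho x : R :=
  Num.max 1 (Num.max (sm_alpha x / sm_mu x)
                     (sm_gamma x / (sm_mu x * (1 - eps)))).

Definition sm_sigma x : R := 1 - sm_gamma x / (sm_rho x * sm_mu x).

Definition sm_zeta x : R :=
  1 / sm_mu x - sm_alpha x / (sm_mu x ^+ 2 * sm_sigma x * sm_rho x).

Definition sm_omega x : R := 1 / (sm_mu x ^+ 2 * sm_sigma x * sm_rho x).

Definition sm_step x : 'cV[R]_n :=
  sm_zeta x *: (A *m x) + sm_omega x *: (A *m A *m x).

Definition sm_objective x : R := enorm x ^+ 2 - Num.sqrt (dot x (A *m x)).

End SplitMerge.

Definition global_minimizer (T : Type) (R : realType) (f : T -> R) (x : T) :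
    Prop :=
  forall y : T, f x <= f y.

(* Main.v *)
(* Write y_i for the coordinates of x in the eigenbasis Q and consider the
   probability weights w_i = lam_i y_i^2 / (x^T A x). Then alpha is the mean of
   lam under w; let V be its variance. With d = rho mu - gamma the update reads
   y_i <- lam_i (1 + (lam_i - alpha) / d) y_i / mu, so that
   w_i <- lam_i^2 (1 + (lam_i - alpha) / d)^2 w_i / c^2, where c is the next
   value of mu. Since rho mu >= alpha and rho mu >= gamma / (1 - eps), one gets
   2 d + gamma - alpha >= d >= eps alpha, whence alpha grows by at least
   V d / (d^2 + V) per step. As alpha <= lam_1 and d stays bounded, V tends to
   0, and c^2 lies between alpha^2 and alpha^2 + K V. If lim alpha < lam_1, then
   c <= lam_1 eventually, so the dominant weights no longer decrease, which
   contradicts (lam_1 - alpha)^2 w_dom <= V -> 0. Hence alpha and mu tend to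
   lam_1 and w concentrates on the dominant eigenspace, where all coordinates
   are always scaled by one common positive factor; the limit of mu determines
   the limit of that factor. *)
Require Import Defs.
From HB Require Import structures.
From mathcomp Require Import all_boot all_order all_algebra.
From mathcomp Require Import all_classical all_reals all_analysis.
From mathcomp Require Import ring lra.
Set Implicit Arguments.
Unset Strict Implicit.
Unset Printing Implicit Defensive.
Import Order.TTheory GRing.Theory Num.Theory numFieldNormedType.Exports.
Local Open Scope classical_set_scope.
Local Open Scope ring_scope.

(** Chebyshev's sum inequality for the similarly ordered [l] and [l ^+ 2]: with [m] the [p]-mean of
    [l], every term (l_i^2 - m^2)(l_i - m) p_i is nonnegative. In other words, reweighting by
    [l ^+ 2] cannot lower the mean of [l]. *)
Lemma moment_le (R : realFieldType) (I : finType) (l p : I -> R)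
    (l_ge0 : forall i, 0 <= l i) (p_ge0 : forall i, 0 <= p i)
    (p_gt0 : 0 < \sum_i p i) :
  (\sum_i l i * p i) * (\sum_i l i ^+ 2 * p i)
    <= (\sum_i p i) * (\sum_i l i ^+ 3 * p i).
Proof.
set t0 := \sum_i p i; set t1 := \sum_i l i * p i.
pose m := t1 / t0.
have mt0 : m * t0 = t1 by rewrite /m divfK ?gt_eqF.
have m_ge0 : 0 <= m.
  apply: divr_ge0; last exact: ltW.
  by apply: sumr_ge0 => i _; rewrite mulr_ge0.
have : 0 <= \sum_i (l i ^+ 2 - m ^+ 2) * (l i - m) * p i.
  apply: sumr_ge0 => i _; apply: mulr_ge0 => //.
  have -> : (l i ^+ 2 - m ^+ 2) * (l i - m) = (l i + m) * (l i - m) ^+ 2.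
    by ring.
  by rewrite mulr_ge0 ?sqr_ge0// addr_ge0.
have -> : \sum_i (l i ^+ 2 - m ^+ 2) * (l i - m) * p i
    = \sum_i l i ^+ 3 * p i - m * (\sum_i l i ^+ 2 * p i)
      - m ^+ 2 * t1 + m ^+ 3 * t0.
  rewrite !mulr_sumr -!sumrN -!big_split/=.
  by apply: eq_bigr => i _; ring.
set t3 := \sum_i l i ^+ 3 * p i; set t2 := \sum_i l i ^+ 2 * p i.
have -> : t3 - m * t2 - m ^+ 2 * t1 + m ^+ 3 * t0 = t3 - m * t2.
  by rewrite -mt0; ring.
rewrite subr_ge0 => /(ler_wpM2l (ltW p_gt0)).
by rewrite -/t0 -mt0 mulrA (mulrC t0 m).
Qed.

(** * One step of the weight dynamics: bounds on the new norm and the new mean *)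

Section OneStep.
Variables (R : realFieldType) (I : finType) (l w : I -> R) (L a V g d : R).
Hypothesis l_bnd : forall i, 0 <= l i <= L.
Hypothesis w_ge0 : forall i, 0 <= w i.
Hypothesis w_sum : \sum_i w i = 1.
Hypothesis aE : \sum_i l i * w i = a.
Hypothesis VE : \sum_i (l i - a) ^+ 2 * w i = V.
Hypothesis gE : \sum_i l i * (l i - a) ^+ 2 * w i = g * V.
Hypothesis d_gt0 : 0 < d.

Let phi i := 1 + (l i - a) / d.

Let l_ge0 i : 0 <= l i. Proof. by case/andP: (l_bnd i). Qed.

Lemma mean_bnd : 0 <= a <= L.
Proof.
rewrite -aE sumr_ge0/=; last by move=> i _; rewrite mulr_ge0.
rewrite -[L]mulr1 -w_sum mulr_sumr; apply: ler_sum => i _.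
by rewrite ler_wpM2r//; case/andP: (l_bnd i).
Qed.

Lemma var_ge0 : 0 <= V.
Proof. by rewrite -VE sumr_ge0// => i _; rewrite mulr_ge0 ?sqr_ge0. Qed.

Lemma sqmean_var : \sum_i l i ^+ 2 * w i = a ^+ 2 + V.
Proof.
have : V = \sum_i l i ^+ 2 * w i - 2 * a * (\sum_i l i * w i)
    + a ^+ 2 * (\sum_i w i).
  rewrite -VE !mulr_sumr -!sumrN -!big_split/=.
  by apply: eq_bigr => i _; ring.
rewrite aE w_sum => ->; ring.
Qed.

Lemma var_le : V <= L ^+ 2.
Proof.
have /andP[a0 aL] := mean_bnd.
have : a ^+ 2 + V <= L ^+ 2.
  rewrite -sqmean_var -[leRHS]mulr1 -w_sum mulr_sumr; apply: ler_sum => i _.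
  rewrite ler_wpM2r//; case/andP: (l_bnd i) => ? ?.
  by rewrite lerXn2r ?nnegrE// (le_trans _ aL).
by have := sqr_ge0 a; lra.
Qed.

(** Expand [phi i ^+ 2]. The cross term comes from l^2 (l - a) = l (l - a)^2 + a l^2 - a^2 l, whose
    weighted sum is g V + a V. *)
Lemma next_norm_expand : \sum_i l i ^+ 2 * phi i ^+ 2 * w i
  = a ^+ 2 + V + 2 * (g + a) * V / d
    + (\sum_i l i ^+ 2 * (l i - a) ^+ 2 * w i) / d ^+ 2.
Proof.
have d0 : d != 0 by rewrite gt_eqF.
have h : \sum_i l i ^+ 2 * (l i - a) * w i = (g + a) * V.
  transitivity (\sum_i l i * (l i - a) ^+ 2 * w i
      + a * (\sum_i l i ^+ 2 * w i) - a ^+ 2 * (\sum_i l i * w i)); last first.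
    by rewrite gE sqmean_var aE; ring.
  rewrite !mulr_sumr -!sumrN -!big_split/=.
  by apply: eq_bigr => i _; ring.
have -> : 2 * (g + a) * V / d = 2 / d * ((g + a) * V) by field.
rewrite -h -sqmean_var mulr_suml !mulr_sumr -!big_split/=.
by apply: eq_bigr => i _; rewrite /phi; field.
Qed.

Lemma next_norm_ge (g_ge0 : 0 <= g) :
  a ^+ 2 <= \sum_i l i ^+ 2 * phi i ^+ 2 * w i.
Proof.
have /andP[a0 aL] := mean_bnd.
rewrite next_norm_expand -!addrA lerDl.
rewrite addr_ge0 ?var_ge0// addr_ge0//.
  by rewrite divr_ge0 ?(ltW d_gt0)// !mulr_ge0 ?var_ge0 ?addr_ge0.
rewrite divr_ge0 ?sqr_ge0// sumr_ge0// => i _.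
by rewrite mulr_ge0// mulr_ge0 ?sqr_ge0.
Qed.

(** The excess over [a ^+ 2] is a multiple of the variance, so it dies out with [V]. The term 4 L
    comes from 2 (g + a) with both [g] and [a] at most [L]. *)
Lemma next_norm_le (g_bnd : 0 <= g <= L) :
  \sum_i l i ^+ 2 * phi i ^+ 2 * w i
    <= a ^+ 2 + V * (1 + 4 * L / d + L ^+ 2 / d ^+ 2).
Proof.
have /andP[a0 aL] := mean_bnd; have /andP[g0 gL] := g_bnd.
have V0 := var_ge0.
rewrite next_norm_expand !mulrDr mulr1 -!addrA lerD2l lerD2l lerD//.
  rewrite mulrA ler_pM2r ?invr_gt0//.
  have -> : V * (4 * L) = 2 * (L + L) * V by ring.
  by apply: ler_wpM2r => //; lra.
rewrite mulrA ler_wpM2r ?invr_ge0 ?sqr_ge0//.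
rewrite -VE mulr_suml; apply: ler_sum => i _.
have /andP[? ?] := l_bnd i.
rewrite -mulrA [leRHS]mulrC; apply: ler_wpM2r.
  by rewrite mulr_ge0 ?sqr_ge0.
by rewrite lerXn2r ?nnegrE// (le_trans _ aL).
Qed.

(* The polynomial step is a tangential gradient step (factor phi), which
   already raises the mean, followed by a power step (factor l). *)
Lemma next_mean_ge (a_gt0 : 0 < a) (g_ge0 : 0 <= g) (dg : a <= d + g) :
  a + V * d / (d ^+ 2 + V)
    <= (\sum_i l i ^+ 3 * phi i ^+ 2 * w i)
       / (\sum_i l i ^+ 2 * phi i ^+ 2 * w i).
Proof.
have d0 : d != 0 by rewrite gt_eqF.
have V0 := var_ge0.
have dV : 0 < d ^+ 2 + V by rewrite ltr_pwDl ?exprn_gt0.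
have c0 : 0 < \sum_i l i ^+ 2 * phi i ^+ 2 * w i.
  by rewrite (lt_le_trans _ (next_norm_ge g_ge0)) ?exprn_gt0.
have h : \sum_i (l i - a) * w i = 0.
  have : \sum_i (l i - a) * w i = (\sum_i l i * w i) - a * (\sum_i w i).
    rewrite !mulr_sumr -!sumrN -!big_split/=.
    by apply: eq_bigr => i _; ring.
  by rewrite aE w_sum mulr1 subrr.
have T0 : \sum_i phi i ^+ 2 * w i = 1 + V / d ^+ 2.
  transitivity (\sum_i w i + 2 / d * (\sum_i (l i - a) * w i)
      + d ^- 2 * (\sum_i (l i - a) ^+ 2 * w i)); last first.
    by rewrite h w_sum VE; field.
  rewrite !mulr_sumr -!big_split/=.
  by apply: eq_bigr => i _; rewrite /phi; field.
have T1 : \sum_i l i * (phi i ^+ 2 * w i) = a + 2 * V / d + g * V / d ^+ 2.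
  transitivity (\sum_i l i * w i + 2 / d * (\sum_i (l i - a) ^+ 2 * w i)
      + 2 * a / d * (\sum_i (l i - a) * w i)
      + d ^- 2 * (\sum_i l i * (l i - a) ^+ 2 * w i)); last first.
    by rewrite h gE VE aE; field.
  rewrite !mulr_sumr -!big_split/=.
  by apply: eq_bigr => i _; rewrite /phi; field.
have T0_gt0 : 0 < \sum_i phi i ^+ 2 * w i.
  by rewrite T0 ltr_pwDl// divr_ge0// sqr_ge0.
have := @moment_le _ _ l (fun i => phi i ^+ 2 * w i) l_ge0
  (fun i => mulr_ge0 (sqr_ge0 _) (w_ge0 i)) T0_gt0.
rewrite T1.
under eq_bigr do rewrite mulrA.
under [X in _ <= _ * X]eq_bigr do rewrite mulrA.
move=> hm; rewrite ler_pdivlMr// -(ler_pM2l T0_gt0); apply: le_trans hm.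
rewrite mulrA ler_wpM2r ?(ltW c0)// T0.
(* Both sides become [a] plus a multiple of V / d^2, so the comparison reduces to a + d <= 2 d + g,
   which is [dg]. *)
have -> : (1 + V / d ^+ 2) * (a + V * d / (d ^+ 2 + V))
    = a + (a + d) * V / d ^+ 2.
  by field; rewrite d0 gt_eqF.
have -> : a + 2 * V / d + g * V / d ^+ 2 = a + (2 * d + g) * V / d ^+ 2.
  by field.
rewrite lerD2l ler_wpM2r ?invr_ge0 ?sqr_ge0// ler_wpM2r//.
by move: dg; lra.
Qed.

End OneStep.

Lemma sqrt_cvg_pos (R : realType) (u : nat -> R) (c : R) :
  (forall k, 0 <= u k) -> 0 <= c ->
  u k ^+ 2 @[k --> \oo] --> c ^+ 2 -> u k @[k --> \oo] --> c.
Proof.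
move=> u0 c0 h.
have -> : u = (fun k => Num.sqrt (u k ^+ 2)).
  by apply/funext => k /=; rewrite sqrtr_sqr ger0_norm.
suff : Num.sqrt (u k ^+ 2) @[k --> \oo] --> Num.sqrt (c ^+ 2).
  by rewrite sqrtr_sqr ger0_norm.
by apply: continuous_cvg h; exact: sqrt_continuous.
Qed.

(** * Asymptotics of the weights under the iterated step *)

Section WeightDynamics.
Variables (R : realType) (I : finType) (l : I -> R) (L e B : R) (i0 : I).
Variables (w : nat -> I -> R) (g d mu : nat -> R).

Let mean k := \sum_i l i * w k i.
Let var k := \sum_i (l i - mean k) ^+ 2 * w k i.
Let phi k i := 1 + (l i - mean k) / d k.

Hypothesis L_gt0 : 0 < L.
Hypothesis e_bnd : 0 < e < 1.
Hypothesis l_bnd : forall i, 0 <= l i <= L.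
Hypothesis l_i0 : l i0 = L.
Hypothesis w_ge0 : forall k i, 0 <= w k i.
Hypothesis w_sum : forall k, \sum_i w k i = 1.
Hypothesis w_i0 : forall k, 0 < w k i0.
Hypothesis g_bnd : forall k, 0 <= g k <= L.
Hypothesis g_var : forall k,
  \sum_i l i * (l i - mean k) ^+ 2 * w k i = g k * var k.
Hypothesis mean_le_dg : forall k, mean k <= d k + g k.
Hypothesis g_le_dg : forall k, g k <= (1 - e) * (d k + g k).
Hypothesis dg_le : forall k, d k + g k <= mu k + B.
Hypothesis mu_ge0 : forall k, 0 <= mu k.
Hypothesis mu_step : forall k,
  mu k.+1 ^+ 2 = \sum_i l i ^+ 2 * phi k i ^+ 2 * w k i.
Hypothesis w_step : forall k i,
  w k.+1 i = l i ^+ 2 * phi k i ^+ 2 * w k i / mu k.+1 ^+ 2.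

Let var_def k : \sum_i (l i - mean k) ^+ 2 * w k i = var k. Proof. by []. Qed.
Let mean_def k : \sum_i l i * w k i = mean k. Proof. by []. Qed.

Let mean_le k : mean k <= L.
Proof. by case/andP: (mean_bnd l_bnd (w_ge0 k) (w_sum k) (mean_def k)). Qed.

Let mean_gt0 k : 0 < mean k.
Proof.
rewrite /mean (bigD1 i0)//= ltr_pwDl ?l_i0 ?mulr_gt0// sumr_ge0// => i _.
by rewrite mulr_ge0//; case/andP: (l_bnd i).
Qed.

Let mean_ge0 k : 0 <= mean k. Proof. exact: ltW. Qed.
Let L_ge0 : 0 <= L. Proof. exact: ltW. Qed.

Let var0 k : 0 <= var k.
Proof. exact: (var_ge0 (w_ge0 k) (var_def k)). Qed.

(** Here [d k + g k] plays the role of rho mu. The safeguard [g_le_dg] leaves [d k] at least the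
    fraction [e] of it, and [mean_le_dg] bounds it below by the mean. *)
Let d_ge k : e * mean k <= d k.
Proof.
have /andP[e0 e1] := e_bnd.
have h : e * mean k <= e * (d k + g k) by rewrite ler_wpM2l// ltW.
by have := g_le_dg k; lra.
Qed.

Let d_gt0 k : 0 < d k.
Proof.
by have /andP[e0 _] := e_bnd; rewrite (lt_le_trans _ (d_ge k))// mulr_gt0.
Qed.

Let g_ge0 k : 0 <= g k. Proof. by case/andP: (g_bnd k). Qed.

Let mean_step k : mean k + var k * d k / (d k ^+ 2 + var k) <= mean k.+1.
Proof.
have -> : mean k.+1 = (\sum_i l i ^+ 3 * phi k i ^+ 2 * w k i)
    / (\sum_i l i ^+ 2 * phi k i ^+ 2 * w k i).
  rewrite -mu_step mulr_suml; apply: eq_bigr => i _.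
  by rewrite w_step; ring.
exact: (next_mean_ge l_bnd (w_ge0 k) (w_sum k) (mean_def k) (var_def k)
  (g_var k) (d_gt0 k) (mean_gt0 k) (g_ge0 k) (mean_le_dg k)).
Qed.

Let mean_nd : nondecreasing_seq mean.
Proof.
apply/nondecreasing_seqP => k; apply: le_trans (mean_step k).
rewrite lerDl divr_ge0 ?mulr_ge0 ?addr_ge0 ?sqr_ge0//.
exact: ltW.
Qed.

(** A lower bound of [d] uniform in [k], since the means never decrease. *)
Let d0 := e * mean 0%N.
Let d0_gt0 : 0 < d0.
Proof. by have /andP[? _] := e_bnd; rewrite mulr_gt0. Qed.

Let d_ge0 k : d0 <= d k.
Proof.
have /andP[? _] := e_bnd.
by apply: le_trans (d_ge k); apply: ler_wpM2l; [exact: ltW | exact: mean_nd].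
Qed.

(** The factor of [next_norm_le] with [d] replaced by its lower bound [d0]. *)
Let K := 1 + 4 * L / d0 + L ^+ 2 / d0 ^+ 2.

Let K_ge0 : 0 <= K.
Proof.
have L0 := ltW L_gt0; have ? := ltW d0_gt0.
apply: addr_ge0; last by rewrite divr_ge0 ?sqr_ge0.
by apply: addr_ge0 => //; apply: divr_ge0 => //; apply: mulr_ge0.
Qed.

Let mu_step_ge k : mean k ^+ 2 <= mu k.+1 ^+ 2.
Proof.
rewrite mu_step; exact: (next_norm_ge l_bnd (w_ge0 k) (w_sum k) (mean_def k)
  (var_def k) (g_var k) (d_gt0 k) (g_ge0 k)).
Qed.

Let mu_step_le k : mu k.+1 ^+ 2 <= mean k ^+ 2 + K * var k.
Proof.
rewrite mu_step; apply: le_trans (next_norm_le l_bnd (w_ge0 k) (w_sum k)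
  (mean_def k) (var_def k) (g_var k) (d_gt0 k) (g_bnd k)) _.
have L0 := ltW L_gt0; have dk0 := ltW (d_gt0 k); have ? := ltW d0_gt0.
rewrite lerD2l mulrC; apply: ler_wpM2r => //; apply: lerD.
  rewrite lerD2l; apply: ler_wpM2l; first exact: mulr_ge0.
  by rewrite lef_pV2 ?posrE.
apply: ler_wpM2l; first exact: sqr_ge0.
by rewrite lef_pV2 ?posrE ?exprn_gt0// lerXn2r ?nnegrE.
Qed.

Let var_bnd k : var k <= L ^+ 2.
Proof.
exact: (var_le l_bnd (w_ge0 k) (w_sum k) (mean_def k) (var_def k)).
Qed.

(** Upper bound of [d]: [mu 0] covers the initial index, the bracket covers later values of [mu],
    and [B] comes from [dg_le]. *)
Let M := mu 0%N + (L ^+ 2 + K * L ^+ 2 + 1) + B.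

Let d_le k : d k <= M.
Proof.
have KL : 0 <= K * L ^+ 2 by rewrite mulr_ge0 ?sqr_ge0.
suff : mu k <= mu 0%N + (L ^+ 2 + K * L ^+ 2 + 1).
  by have := dg_le k; have := g_ge0 k; rewrite /M; lra.
have L2 := sqr_ge0 L.
case: k => [|k]; first by lra.
have mL : mean k ^+ 2 <= L ^+ 2 by rewrite lerXn2r ?nnegrE.
have KV : K * var k <= K * L ^+ 2 by rewrite ler_wpM2l.
(* Nonnegativity of (mu - 1)^2 turns the bound on the square of [mu] into a bound on [mu] itself. *)
have := mu_step_le k; have := mu_ge0 0%N; have := sqr_ge0 (mu k.+1 - 1).
rewrite sqrrB1; lra.
Qed.

(** Solves the gain in [mean_step] for the variance, using d0 <= d <= M and var <= L^2. *)
Let var_le_mean_step k :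
  var k <= (M ^+ 2 + L ^+ 2) / d0 * (mean k.+1 - mean k).
Proof.
have dk := d_gt0 k; have dk0 := ltW dk; have v0 := var0 k.
have M0 : 0 < M by rewrite (lt_le_trans dk).
have dV : 0 < d k ^+ 2 + var k by rewrite ltr_pwDl ?exprn_gt0.
have : var k * d k / (d k ^+ 2 + var k) <= mean k.+1 - mean k.
  by rewrite lerBrDl; exact: mean_step.
set D := _ - mean k => hD.
have D0 : 0 <= D.
  by apply: le_trans hD; rewrite divr_ge0 ?mulr_ge0// ltW.
rewrite mulrAC ler_pdivlMr//; apply: (@le_trans _ _ (var k * d k)).
  by rewrite ler_wpM2l// d_ge0.
move: hD; rewrite ler_pdivrMr// => /le_trans; apply.
rewrite [leRHS]mulrC; apply: ler_wpM2l => //; apply: lerD => //.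
by rewrite lerXn2r ?nnegrE ?d_le// ltW.
Qed.

Let mean_cvg : cvgn mean.
Proof.
apply: nondecreasing_is_cvgn => //.
by exists L => _ [k _ <-].
Qed.

(** The means are monotone and bounded, so their increments, which control the variance, tend to
    0. *)
Lemma var_to0 : var k @[k --> \oo] --> 0.
Proof.
have h : ((M ^+ 2 + L ^+ 2) / d0 * (mean k.+1 - mean k)) @[k --> \oo] --> 0.
  rewrite -[X in _ --> X](mulr0 ((M ^+ 2 + L ^+ 2) / d0)).
  apply: cvgMl_tmp; rewrite -(subrr (limn mean)); apply: cvgB => //.
  by rewrite cvg_shiftS.
apply: squeeze_cvgr (cvg_cst 0) h.
by near=> k; rewrite var0 var_le_mean_step.
Unshelve. all: by end_near. Qed.

Let dominant_le_var k : (L - mean k) ^+ 2 * w k i0 <= var k.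
Proof.
rewrite /var (bigD1 i0)//= l_i0 lerDl sumr_ge0// => i _.
by rewrite mulr_ge0 ?sqr_ge0.
Qed.

(* If the means stayed below some b < L, then eventually the new norm would be
   at most L, so the weight at i0 would stop decreasing, contradicting
   dominant_le_var. *)
Lemma mean_to_max : mean k @[k --> \oo] --> L.
Proof.
suff -> : L = limn mean by [].
apply/eqP; rewrite eq_le andbC limr_le//=; last by near=> k; exact: mean_le.
rewrite leNgt; apply/negP; set b := limn mean => bL.
have mean_b k : mean k <= b by exact: nondecreasing_cvgn_le.
have b0 : 0 <= b by rewrite (le_trans _ (mean_b 0%N)).
have KV : K * var k @[k --> \oo] --> 0.
  by rewrite -(mulr0 K); apply: cvgMl_tmp; exact: var_to0.
have bL2 : 0 < L ^+ 2 - b ^+ 2.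
  by rewrite subr_sqr mulr_gt0 ?subr_gt0// ltr_pwDl.
(* This threshold gives mu^2 <= mean^2 + K var <= b^2 + (L^2 - b^2) = L^2 from [N] on. *)
have [N _ hN] := cvgr_le _ KV _ bL2.
have w_nd k : (N <= k)%N -> w k i0 <= w k.+1 i0.
  move=> Nk; rewrite w_step l_i0 mulrAC ler_peMl//.
  have mb : mean k ^+ 2 <= b ^+ 2 by rewrite lerXn2r ?nnegrE.
  have mu0 : 0 < mu k.+1 ^+ 2.
    by rewrite (lt_le_trans _ (mu_step_ge k))// exprn_gt0.
  rewrite ler_pdivlMr// mul1r.
  apply: (@le_trans _ _ (L ^+ 2)).
    by have := mu_step_le k; have := hN k Nk => /=; lra.
  rewrite ler_peMr ?sqr_ge0// exprn_ege1//.
  by rewrite /phi lerDl l_i0 divr_ge0 ?subr_ge0// ltW.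
have w_N k : w N i0 <= w (N + k)%N i0.
  elim: k => [|k /le_trans]; first by rewrite addn0.
  by apply; rewrite addnS w_nd// leq_addr.
have lb : 0 < (L - b) ^+ 2 * w N i0.
  by rewrite mulr_gt0// exprn_gt0// subr_gt0.
have [N' _ hN'] := cvgr_lt _ var_to0 _ lb.
have := hN' (N + N')%N (leq_addl _ _); rewrite /= ltNge => /negP; apply.
apply: le_trans (dominant_le_var _).
apply: ler_pM; rewrite ?sqr_ge0 ?w_N//.
by rewrite lerXn2r ?nnegrE ?subr_ge0 ?lerD2l ?lerN2//; apply: ltW.
Unshelve. all: by end_near. Qed.

(** Squeeze the square of [mu k.+1] between mean^2 and mean^2 + K var. The shift is harmless and
    skips [mu 0], on which the recurrence says nothing. *)
Lemma mu_to_max : mu k @[k --> \oo] --> L.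
Proof.
rewrite -(cvg_shiftS mu).
have sq : mu k.+1 ^+ 2 @[k --> \oo] --> L ^+ 2.
  have m2 : mean k ^+ 2 @[k --> \oo] --> L ^+ 2.
    by rewrite expr2; under eq_fun do rewrite expr2; apply: cvgM;
      exact: mean_to_max.
  have h : mean k ^+ 2 + K * var k @[k --> \oo] --> L ^+ 2.
    rewrite -[X in _ --> X]addr0 -[X in _ + X](mulr0 K); apply: cvgD => //.
    by apply: cvgMl_tmp; exact: var_to0.
  apply: squeeze_cvgr m2 h.
  by near=> k; rewrite mu_step_ge mu_step_le.
by apply: sqrt_cvg_pos sq => // k; exact: mu_ge0.
Unshelve. all: by end_near. Qed.

(** Markov's inequality: L - mean is the sum of the nonnegative terms (L - l_j) w_j, hence dominates
    (L - l_i) w_i. *)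
Lemma weight_to0 i : l i < L -> w k i @[k --> \oo] --> 0.
Proof.
move=> liL.
have h : (L - l i)^-1 * (L - mean k) @[k --> \oo] --> 0.
  rewrite -(mulr0 (L - l i)^-1); apply: cvgMl_tmp.
  rewrite -[X in _ --> X](subrr L); apply: cvgB; first exact: cvg_cst.
  exact: mean_to_max.
apply: squeeze_cvgr (cvg_cst 0) h; near=> k; rewrite w_ge0/= mulrC.
rewrite ler_pdivlMr ?subr_gt0//.
have -> : L - mean k = \sum_i (L - l i) * w k i.
  rewrite -[L in LHS]mulr1 -(w_sum k) mulr_sumr -sumrB.
  by apply: eq_bigr => j _; rewrite mulrBl.
rewrite (bigD1 i)//= mulrC lerDl sumr_ge0// => j _.
by rewrite mulr_ge0// subr_ge0; case/andP: (l_bnd j).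
Unshelve. all: by end_near. Qed.

End WeightDynamics.

Lemma cvg_cV (R : realType) (n : nat) (u : nat -> 'cV[R]_n.+1)
    (v : 'cV[R]_n.+1) :
  (forall i, u k i ord0 @[k --> \oo] --> v i ord0) -> u k @[k --> \oo] --> v.
Proof.
move=> h; apply/cvg_mx_entourageP => E entE.
suff : \forall k \near \oo, forall i, E (v i ord0, u k i ord0).
  by apply: filterS => k hk i j; rewrite ord1 inE.
apply: filter_forall => i.
exact: ((cvg_entourageP _ _).1 (h i) E entE).
Qed.

(** * Inner product and orthogonal projection *)

Section Dot.
Variables (R : realType) (n : nat).
Implicit Types u v : 'cV[R]_n.

Lemma dotE u v : dot u v = \sum_i u i ord0 * v i ord0.
Proof. by rewrite /dot mxE; apply: eq_bigr => i _; rewrite mxE. Qed.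

Lemma dot_ge0 u : 0 <= dot u u.
Proof. by rewrite dotE sumr_ge0// => i _; rewrite -expr2 sqr_ge0. Qed.

Lemma dot_eq0 u : dot u u = 0 -> u = 0.
Proof.
rewrite dotE => /psumr_eq0P h; apply/colP => i; rewrite mxE.
apply/eqP; rewrite -sqrf_eq0 expr2 h// => j _; by rewrite -expr2 sqr_ge0.
Qed.

Lemma enorm_sq u : enorm u ^+ 2 = dot u u.
Proof. by rewrite sqr_sqrtr ?dot_ge0. Qed.

(** A row vector lying both in [U] and in [kermx U^T] is orthogonal to itself, hence zero. So
    [proj_mx] fixes the first space and kills the second. *)
Lemma orthproj_unique (U : 'M[R]_n) (x p : 'cV[R]_n) :
  (p^T <= U)%MS -> U *m (x - p) = 0 -> orthproj U x = p.
Proof.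
move=> pU Uxp; rewrite /orthproj.
have dU : (U :&: kermx U^T = 0)%MS.
  apply/eqP; rewrite -submx0; apply/rV_subP => v.
  rewrite sub_capmx => /andP[/submxP[a ->] /sub_kermxP h].
  rewrite submx0; apply/eqP/trmx_inj; rewrite trmx0; apply: dot_eq0.
  by rewrite /dot trmxK trmx_mul mulmxA h mul0mx mxE.
have -> : x^T = p^T + (x - p)^T by rewrite -linearD/= subrKC.
rewrite mulmxDl proj_mx_id// proj_mx_0 ?addr0 ?trmxK//.
by apply/sub_kermxP; rewrite -trmx_mul Uxp trmx0.
Qed.

End Dot.

(** * The algorithm in eigenbasis coordinates *)

Section SpectralCoordinates.
Variables (R : realType) (n : nat) (A Q : 'M[R]_n.+1) (lam : 'rV[R]_n.+1).
Hypothesis QTQ : Q^T *m Q = 1%:M.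
Hypothesis AE : A = Q *m diag_mx lam *m Q^T.

Let l i := lam ord0 i.

Definition ecoord x i := (Q^T *m x) i (ord0 : 'I_1).

Lemma coord_dot u v : dot u v = \sum_i ecoord u i * ecoord v i.
Proof.
have -> : dot u v = dot (Q^T *m u) (Q^T *m v); last by rewrite dotE.
by rewrite /dot trmx_mul trmxK !mulmxA -(mulmxA _ Q) (mulmx1C QTQ) mulmx1.
Qed.

Lemma coordA u i : ecoord (A *m u) i = l i * ecoord u i.
Proof.
rewrite /ecoord AE !mulmxA QTQ mul1mx -mulmxA mul_diag_mx mxE.
by [].
Qed.

Lemma coordD u v i : ecoord (u + v) i = ecoord u i + ecoord v i.
Proof. by rewrite /ecoord mulmxDr mxE. Qed.

Lemma coordZ a u i : ecoord (a *: u) i = a * ecoord u i.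
Proof. by rewrite /ecoord -scalemxAr mxE. Qed.

Lemma coordB u v i : ecoord (u - v) i = ecoord u i - ecoord v i.
Proof. by rewrite /ecoord mulmxBr !mxE. Qed.

Lemma coord_expand (x : 'cV[R]_n.+1) i : x i ord0 = \sum_j Q i j * ecoord x j.
Proof.
rewrite -[x in LHS]mul1mx -(mulmx1C QTQ) -mulmxA mxE.
by [].
Qed.

Lemma cvg_coord (u : nat -> 'cV[R]_n.+1) v :
  (forall i, ecoord (u k) i @[k --> \oo] --> ecoord v i) ->
  u k @[k --> \oo] --> v.
Proof.
move=> h; apply: cvg_cV => i; rewrite coord_expand.
under eq_fun do rewrite coord_expand.
apply: cvg_big => [|j _]; first exact: add_continuous.
exact: cvgMl_tmp.
Qed.

Lemma coord_dominant_proj (m : nat) x i :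
  ecoord (orthproj (dominant_space Q m) x) i
    = if (i < m)%N then ecoord x i else 0.
Proof.
(* Truncated coordinates: [Q *m t] is the candidate fed to [orthproj_unique]. *)
pose t : 'cV[R]_n.+1 := \col_j (if (j < m)%N then ecoord x j else 0).
rewrite (@orthproj_unique _ _ _ _ (Q *m t)).
- by rewrite /ecoord mulmxA QTQ mul1mx mxE.
- rewrite trmx_mul mulmx_sum_row; apply: summx_sub => j _.
  rewrite !mxE; case: ifP => jm; last by rewrite scale0r sub0mx.
  by apply/scalemx_sub/(sumsmx_sup j) => //; rewrite genmxE tr_col.
apply/sub_kermxP/sumsmx_subP => j jm; rewrite genmxE; apply/sub_kermxP.
have -> : x - Q *m t = Q *m (Q^T *m x - t).
  by rewrite mulmxBr mulmxA (mulmx1C QTQ) mul1mx.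
rewrite tr_col -row_mul mulmxA QTQ mul1mx; apply/rowP => k.
by rewrite ord1 !mxE jm /ecoord mxE subrr.
Qed.

Variable x : 'cV[R]_n.+1.

Let y := ecoord x.
Let S := dot x (A *m x).

(** Kernel directions of [A] get weight 0, so the weights do not see those coordinates; they are
    treated separately in [dominated_coord_lim]. *)
Definition weight i := l i * ecoord x i ^+ 2 / dot x (A *m x).

Lemma coord_energy : S = \sum_i l i * y i ^+ 2.
Proof.
by rewrite /S coord_dot; apply: eq_bigr => i _; rewrite coordA /y; ring.
Qed.

Hypothesis S_gt0 : 0 < S.

Let SE i : l i * y i ^+ 2 = S * weight i.
Proof. by rewrite /weight -/S -/(y i) [RHS]mulrC divfK ?gt_eqF. Qed.

Lemma weight_sum : \sum_i weight i = 1.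
Proof. by rewrite -mulr_suml -coord_energy divff ?gt_eqF. Qed.

Lemma alphaE : sm_alpha A x = \sum_i l i * weight i.
Proof.
rewrite /sm_alpha -/S -mulmxA coord_dot mulr_suml; apply: eq_bigr => i _.
by rewrite !coordA /weight -/S; ring.
Qed.

Let a := sm_alpha A x.
Let V := \sum_i (l i - a) ^+ 2 * weight i.

Lemma coord_residual i : ecoord (sm_residual A x) i = l i * (l i - a) * y i.
Proof.
by rewrite /sm_residual coordB coordZ -mulmxA !coordA -/a /y; ring.
Qed.

Lemma residual_sq :
  enorm (sm_residual A x) ^+ 2 = S * \sum_i l i * (l i - a) ^+ 2 * weight i.
Proof.
rewrite enorm_sq coord_dot mulr_sumr; apply: eq_bigr => i _.
have -> : S * (l i * (l i - a) ^+ 2 * weight i)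
  = l i * (l i - a) ^+ 2 * (S * weight i) by ring.
by rewrite -SE coord_residual; ring.
Qed.

(** Since the deviations l - a have weighted mean 0, replacing one factor [l] by l - a changes
    nothing and produces the variance. *)
Lemma residual_dot : dot (A *m x) (sm_residual A x) = S * V.
Proof.
have -> : V = \sum_i l i * (l i - a) * weight i.
  have h : \sum_i (l i - a) * weight i = 0.
    under eq_bigr do rewrite mulrBl.
    by rewrite sumrB -alphaE -mulr_sumr weight_sum mulr1 subrr.
  apply/eqP; rewrite -subr_eq0 -sumrB; apply/eqP.
  transitivity (- a * \sum_i (l i - a) * weight i); last by rewrite h mulr0.
  by rewrite mulr_sumr; apply: eq_bigr => i _; ring.
rewrite coord_dot mulr_sumr; apply: eq_bigr => i _.
have -> : S * (l i * (l i - a) * weight i)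
  = l i * (l i - a) * (S * weight i) by ring.
by rewrite -SE coord_residual coordA -/y; ring.
Qed.

Variables (L e : R).
Hypothesis l_bnd : forall i, 0 <= l i <= L.
Hypothesis e_bnd : 0 < e < 1.

Lemma weight_ge0 i : 0 <= weight i.
Proof.
have /andP[l0 _] := l_bnd i.
by apply: divr_ge0; [rewrite mulr_ge0 ?sqr_ge0 | exact: ltW].
Qed.

Let g := sm_gamma A x.
Let mu := sm_mu A x.
Let D := sm_rho A e x * mu.

Let num_le : \sum_i l i * (l i - a) ^+ 2 * weight i <= L * V.
Proof.
rewrite mulr_sumr; apply: ler_sum => i _; rewrite -mulrA ler_wpM2r//.
  by rewrite mulr_ge0 ?sqr_ge0 ?weight_ge0.
by case/andP: (l_bnd i).
Qed.

Let num_ge0 : 0 <= \sum_i l i * (l i - a) ^+ 2 * weight i.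
Proof.
apply: sumr_ge0 => i _; have /andP[l0 _] := l_bnd i.
by rewrite mulr_ge0 ?weight_ge0// mulr_ge0 ?sqr_ge0.
Qed.

Let V_ge0 : 0 <= V.
Proof. by apply: sumr_ge0 => i _; rewrite mulr_ge0 ?sqr_ge0 ?weight_ge0. Qed.

Let gE : g = (\sum_i l i * (l i - a) ^+ 2 * weight i) / V.
Proof.
rewrite /g /sm_gamma residual_sq residual_dot invfM mulrACA.
by rewrite divff ?mul1r ?gt_eqF.
Qed.

(** Division-free form of [gE]: [gamma] is the mean of [l] under weights proportional to (l - a)^2
    w. If [V] is 0, the numerator is at most L V and vanishes too. *)
Lemma gamma_var : \sum_i l i * (l i - a) ^+ 2 * weight i = g * V.
Proof.
have [V0|V0] := eqVneq V 0; last by rewrite gE divfK.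
rewrite V0 mulr0; apply/eqP; rewrite eq_le num_ge0 andbT.
by rewrite (le_trans num_le)// V0 mulr0.
Qed.

Lemma gamma_bnd : 0 <= g <= L.
Proof.
have L0 : 0 <= L by case/andP: (l_bnd ord0) => /le_trans h /h.
rewrite gE divr_ge0//=.
have [->|V0] := eqVneq V 0; first by rewrite invr0 mulr0.
by rewrite ler_pdivrMr// lt_def V0.
Qed.

Lemma mu_sq : mu ^+ 2 = 4 * S.
Proof. by rewrite /mu /sm_mu exprMn sqr_sqrtr ?(ltW S_gt0)// -/S; ring. Qed.

Lemma mu_gt0 : 0 < mu.
Proof. by rewrite mulr_gt0 ?sqrtr_gt0. Qed.

Lemma alpha_bnd : 0 <= a <= L.
Proof. exact: (mean_bnd l_bnd weight_ge0 weight_sum (esym alphaE)). Qed.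

(** One inequality for each entry of the maximum defining [sm_rho]. *)
Lemma rho_mu_ge : [/\ mu <= D, a <= D & g <= (1 - e) * D].
Proof.
have m0 := mu_gt0; have /andP[e0 e1] := e_bnd.
have m1 : 0 < mu * (1 - e) by rewrite mulr_gt0// subr_gt0.
split.
- by rewrite ler_peMl ?(ltW m0)// /sm_rho le_max lexx.
- by rewrite -ler_pdivrMr// /sm_rho !le_max lexx !orbT.
rewrite /D mulrCA (mulrC _ mu) -ler_pdivrMr//.
by rewrite /sm_rho !le_max lexx !orbT.
Qed.

(** A maximum of nonnegative numbers is at most their sum; [alpha] and [gamma] are at most [L]. *)
Lemma rho_mu_le : D <= mu + (L + L / (1 - e)).
Proof.
have m0 := mu_gt0; have /andP[e0 e1] := e_bnd.
have /andP[a0 aL] := alpha_bnd; have /andP[g0 gL] := gamma_bnd.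
have e1' : 0 < 1 - e by rewrite subr_gt0.
have L0 : 0 <= L by exact: le_trans aL.
have Le : 0 <= L / (1 - e) by rewrite divr_ge0// ltW.
rewrite -ler_pdivlMr// /sm_rho !ge_max; apply/and3P; split.
- by rewrite ler_pdivlMr// mul1r lerDl addr_ge0.
- rewrite ler_pM2r ?invr_gt0// -[leLHS]add0r lerD ?(ltW m0)//.
  by rewrite -[leLHS]addr0 lerD.
rewrite -/mu -/g invfM mulrCA mulrC ler_pM2r ?invr_gt0//.
rewrite -[leLHS]add0r lerD ?(ltW m0)// -[leLHS]add0r lerD//.
by rewrite ler_pM2r ?invr_gt0.
Qed.

Lemma coord_step i : ecoord (sm_step A e x) i
  = l i * (1 + (l i - a) / (D - g)) / mu * y i.
Proof.
have m0 := mu_gt0; have /andP[e0 e1] := e_bnd.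
have [mD aD gD] := rho_mu_ge; have /andP[g0 gL] := gamma_bnd.
have D0 : 0 < D by exact: lt_le_trans mD.
have dpos : 0 < D - g.
  have : 0 < e * D by rewrite mulr_gt0.
  by move: gD; lra.
rewrite /sm_step coordD !coordZ -mulmxA !coordA /sm_zeta /sm_omega -/mu -/a -/y.
(* The common denominator of zeta and omega simplifies because sigma = 1 - g / D with D = rho mu. *)
have -> : mu ^+ 2 * sm_sigma A e x * sm_rho A e x = mu * (D - g).
  rewrite /sm_sigma -/g -/mu -/D.
  have -> : mu ^+ 2 * (1 - g / D) * sm_rho A e x = mu * ((1 - g / D) * D).
    by set s := 1 - _; rewrite /D; ring.
  by congr (_ * _); field; rewrite gt_eqF.
by rewrite /y; field; rewrite !gt_eqF.
Qed.

End SpectralCoordinates.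

(** The value at [t] is -L/4. For any [y], with N = |y|^2 and s^2 = y^T A y <= L N, one has L (N - s
    + L/4) >= (s - L/2)^2 >= 0. *)
Lemma objective_minimizer (R : realType) (n : nat) (A : 'M[R]_n) (L : R)
    (t : 'cV[R]_n) (L_gt0 : 0 < L)
    (A_psd : forall y, 0 <= dot y (A *m y))
    (A_le : forall y, dot y (A *m y) <= L * dot y y)
    (tt : dot t t = L / 4) (tAt : dot t (A *m t) = L ^+ 2 / 4) :
  global_minimizer (sm_objective A) t.
Proof.
move=> y; rewrite /sm_objective !enorm_sq tt tAt.
have -> : L ^+ 2 / 4 = (L / 2) ^+ 2 by field.
rewrite sqrtr_sqr ger0_norm; last by rewrite divr_ge0// ltW.
set s := Num.sqrt _; set N := dot y y.
have ss : s ^+ 2 <= L * N by rewrite sqr_sqrtr.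
suff : 0 <= N - s + L / 4 by lra.
rewrite -(pmulr_rge0 _ L_gt0); apply: le_trans (sqr_ge0 (s - L / 2)) _.
have -> : (s - L / 2) ^+ 2 = s ^+ 2 - L * s + L * L / 4 by field.
by move: ss; rewrite !mulrDr; lra.
Qed.

(** * Convergence of the eigenbasis coordinates of the iterates *)

Section Iterates.
Variables (R : realType) (n : nat) (A Q : 'M[R]_n.+1) (lam : 'rV[R]_n.+1).
Variables (m : nat) (e L : R) (x : nat -> 'cV[R]_n.+1) (i0 : 'I_n.+1).
Hypothesis QTQ : Q^T *m Q = 1%:M.
Hypothesis AE : A = Q *m diag_mx lam *m Q^T.
Hypothesis L_gt0 : 0 < L.
Hypothesis lam_bnd : forall i, 0 <= lam ord0 i <= L.
Hypothesis lam_dominant : forall i : 'I_n.+1, (i < m)%N = (lam ord0 i == L).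
Hypothesis e_bnd : 0 < e < 1.
Hypothesis x_step : forall k, x k.+1 = sm_step A e (x k).
Hypothesis i0m : (i0 < m)%N.
Hypothesis x_i0 : ecoord Q (x 0%N) i0 != 0.

Let y k i := ecoord Q (x k) i.
Let l i := lam ord0 i.
Let S k := dot (x k) (A *m x k).
Let w k i := weight A Q lam (x k) i.
Let a k := sm_alpha A (x k).
Let g k := sm_gamma A (x k).
Let mu k := sm_mu A (x k).
Let d k := sm_rho A e (x k) * mu k - g k.
(** The factor by which one step multiplies every dominant coordinate. *)
Let c k := L * (1 + (L - a k) / d k) / mu k.

Let l_m (i : 'I_n.+1) : (i < m)%N -> l i = L.
Proof. by rewrite lam_dominant => /eqP. Qed.

Let energy_gt0 k : y k i0 != 0 -> 0 < S k.
Proof.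
move=> yk; rewrite /S (coord_energy QTQ AE) (bigD1 i0)//= ltr_pwDl//.
  by rewrite -/(l i0) l_m// mulr_gt0// exprn_even_gt0.
apply: sumr_ge0 => i _; have /andP[? _] := lam_bnd i.
by rewrite mulr_ge0 ?sqr_ge0.
Qed.

Let d_gt0 k : 0 < S k -> 0 < d k.
Proof.
move=> Sk; have [mD aD gD] := rho_mu_ge Sk e_bnd.
have m0 := mu_gt0 Sk; have /andP[e0 e1] := e_bnd.
have : 0 < e * (sm_rho A e (x k) * sm_mu A (x k)).
  by rewrite mulr_gt0// (lt_le_trans m0).
by move: gD; rewrite /d /mu /g; lra.
Qed.

Let y_step k i : 0 < S k ->
  y k.+1 i = l i * (1 + (l i - a k) / d k) / mu k * y k i.
Proof.
by move=> Sk; rewrite /y x_step (coord_step QTQ AE Sk lam_bnd e_bnd).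
Qed.

Let c_gt0 k : 0 < S k -> 0 < c k.
Proof.
move=> Sk; have /andP[_ aL] := alpha_bnd QTQ AE Sk lam_bnd.
rewrite divr_gt0 ?mu_gt0// mulr_gt0// ltr_pwDl//.
by rewrite divr_ge0 ?(ltW (d_gt0 Sk))// subr_ge0.
Qed.

(** Induction tying two facts together: a nonzero coordinate at [i0] makes the energy positive, and
    positive energy validates the step formula, whose factor [c k] is positive. *)
Let y_i0 k : y k i0 != 0.
Proof.
elim: k => [//|k yk]; have Sk := energy_gt0 yk.
by rewrite y_step// l_m// mulf_neq0// gt_eqF// c_gt0.
Qed.

Let S_gt0 k : 0 < S k. Proof. exact: energy_gt0. Qed.

Let l_y_sq k i : l i * y k i ^+ 2 = S k * w k i.
Proof.
have Sk := S_gt0 k.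
by rewrite /w /weight -/(l i) -/(y k i) -/(S k) [RHS]mulrC divfK ?gt_eqF.
Qed.

Let mu_sq4 k : mu k ^+ 2 = 4 * S k. Proof. exact: (mu_sq (S_gt0 k)). Qed.

(** The energy cancels: l y^2 = S w is divided by mu^2 = 4 S, leaving only the factor 1/4. *)
Let l_y_sq_step k i : l i * y k.+1 i ^+ 2
  = l i ^+ 2 * (1 + (l i - a k) / d k) ^+ 2 * w k i / 4.
Proof.
have Sk := S_gt0 k; have mk : 0 < mu k by exact: mu_gt0.
rewrite y_step//; set phi := 1 + _ / d k.
have -> : l i * (l i * phi / mu k * y k i) ^+ 2
    = l i ^+ 2 * phi ^+ 2 * (l i * y k i ^+ 2) / mu k ^+ 2.
  by field; rewrite gt_eqF.
by rewrite l_y_sq mu_sq4; field; rewrite gt_eqF.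
Qed.

Let meanE k : \sum_i l i * w k i = a k.
Proof. by rewrite /a (alphaE QTQ AE). Qed.

Let mu_step k : mu k.+1 ^+ 2
  = \sum_i l i ^+ 2 * (1 + (l i - \sum_j l j * w k j) / d k) ^+ 2 * w k i.
Proof.
rewrite mu_sq4 /S (coord_energy QTQ AE) mulr_sumr; apply: eq_bigr => i _.
by rewrite l_y_sq_step meanE; field; rewrite gt_eqF// d_gt0.
Qed.

Let w_step k i : w k.+1 i
  = l i ^+ 2 * (1 + (l i - \sum_j l j * w k j) / d k) ^+ 2 * w k i
    / mu k.+1 ^+ 2.
Proof.
rewrite meanE mu_sq4; set z := _ * w k i.
have -> : z = 4 * (l i * y k.+1 i ^+ 2) by rewrite l_y_sq_step -/z; field.
by rewrite l_y_sq; field; rewrite gt_eqF.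
Qed.

Let w_i0 k : 0 < w k i0.
Proof.
rewrite -(pmulr_rgt0 _ (S_gt0 k)) -l_y_sq l_m// mulr_gt0//.
by rewrite exprn_even_gt0// y_i0.
Qed.

(** Instance of the abstract weight dynamics with d + g = rho mu and [B] equal to L + L / (1 -
    e). *)
Let mu_weight_lim : mu k @[k --> \oo] --> L /\
  forall i, l i < L -> w k i @[k --> \oo] --> 0.
Proof.
have w0 k i : 0 <= w k i by exact: (weight_ge0 Q (S_gt0 k) lam_bnd).
have w1 k : \sum_i w k i = 1 by exact: (weight_sum QTQ AE (S_gt0 k)).
have gb k : 0 <= g k <= L by exact: (gamma_bnd QTQ AE (S_gt0 k) lam_bnd).
have gv k : \sum_i l i * (l i - \sum_j l j * w k j) ^+ 2 * w k i
    = g k * \sum_i (l i - \sum_j l j * w k j) ^+ 2 * w k i.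
  by rewrite meanE (gamma_var QTQ AE (S_gt0 k) lam_bnd).
have D k : d k + g k = sm_rho A e (x k) * sm_mu A (x k) by rewrite /d subrK.
have ad k : \sum_j l j * w k j <= d k + g k.
  by rewrite meanE D; case: (rho_mu_ge (S_gt0 k) e_bnd).
have gd k : g k <= (1 - e) * (d k + g k).
  by rewrite D; case: (rho_mu_ge (S_gt0 k) e_bnd).
have dB k : d k + g k <= mu k + (L + L / (1 - e)).
  by rewrite D; exact: (rho_mu_le QTQ AE (S_gt0 k) lam_bnd e_bnd).
have m0 k : 0 <= mu k by apply/ltW/(mu_gt0 (S_gt0 k)).
split=> [|i li].
  exact: (mu_to_max L_gt0 e_bnd lam_bnd (l_m i0m) w0 w1 w_i0 gb gv ad gd dB m0
    mu_step w_step).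
exact: (weight_to0 L_gt0 e_bnd lam_bnd (l_m i0m) w0 w1 w_i0 gb gv ad gd dB m0
  mu_step w_step).
Qed.

(** The accumulated factor of the dominant coordinates; being common to all of them, it keeps the
    direction of the dominant component fixed. *)
Let P k := y k i0 / y 0%N i0.

Let y_dominant k (i : 'I_n.+1) : (i < m)%N -> y k i = P k * y 0%N i.
Proof.
move=> im; elim: k => [|k IH]; first by rewrite /P divff// mul1r.
by rewrite y_step// IH /P y_step// l_m// l_m//; ring.
Qed.

Let P_gt0 k : 0 < P k.
Proof.
elim: k => [|k IH]; first by rewrite /P divff.
by rewrite /P y_step// l_m// -mulrA mulr_gt0// c_gt0.
Qed.

Let energy_lim : S k @[k --> \oo] --> L ^+ 2 / 4.
Proof.
have [h _] := mu_weight_lim.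
have -> : S = (fun k => mu k * mu k / 4).
  by apply/funext => k; rewrite -expr2 mu_sq4; field.
by rewrite expr2; apply: cvgMr_tmp; exact: cvgM.
Qed.

(** For a zero eigenvalue the coordinate vanishes after one step. Otherwise y^2 = S w / l, where [S]
    converges and [w] tends to 0. *)
Lemma dominated_coord_lim (i : 'I_n.+1) :
  ~~ (i < m)%N -> ecoord Q (x k) i @[k --> \oo] --> 0.
Proof.
move=> im; rewrite -/(y _ i).
have [/andP[l0 lL] lne] : 0 <= l i <= L /\ l i != L.
  by rewrite lam_bnd -lam_dominant.
have [li0|li0] := eqVneq (l i) 0.
  rewrite -cvg_shiftS; have -> : [sequence ecoord Q (x k.+1) i]_k = (fun=> 0).
    apply/funext => k /=; rewrite -/(y k.+1 i) y_step// li0 !mul0r //.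
  exact: cvg_cst.
have li : 0 < l i by rewrite lt_def li0.
apply/norm_cvg0P; apply: sqrt_cvg_pos => //.
have h : S k * w k i / l i @[k --> \oo] --> L ^+ 2 / 4 * 0 / l i.
  apply: cvgMr_tmp; apply: cvgM; first exact: energy_lim.
  by apply: mu_weight_lim.2; rewrite lt_neqAle lne.
move: h; rewrite mulr0 mul0r expr0n/=.
suff -> : (fun k => S k * w k i / l i)
    = (fun k => `|ecoord Q (x k) i| ^+ 2) by [].
apply/funext => k; rewrite -l_y_sq real_normK ?num_real// -/(y k i).
by rewrite mulrC mulKf.
Qed.

(** Only the limit of [P] is at stake. The energy times the total dominant weight is P^2 L p2; the
    energy tends to L^2/4 and that weight to 1, so P^2 tends to L / (4 p2). *)
Lemma dominant_coord_lim (i : 'I_n.+1) : (i < m)%N ->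
  ecoord Q (x k) i @[k --> \oo] -->
    Num.sqrt L / (2 * Num.sqrt (\sum_(j < n.+1 | (j < m)%N)
                                  ecoord Q (x 0%N) j ^+ 2))
      * ecoord Q (x 0%N) i.
Proof.
move=> im; set p2 := \sum_(j < n.+1 | (j < m)%N) _.
have p2_gt0 : 0 < p2.
  rewrite /p2 (bigD1 i0)//= ltr_pwDl ?exprn_even_gt0//.
  by apply: sumr_ge0 => j _; exact: sqr_ge0.
suff h : P k @[k --> \oo] --> Num.sqrt L / (2 * Num.sqrt p2).
  have -> : (fun k => ecoord Q (x k) i) = (fun k => P k * ecoord Q (x 0%N) i).
    by apply/funext => k; exact: y_dominant.
  exact: cvgMr_tmp.
apply: sqrt_cvg_pos => [k|| ]; first exact: ltW.
  by rewrite divr_ge0 ?mulr_ge0 ?sqrtr_ge0.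
have PE k : P k ^+ 2
    = S k * (1 - \sum_(j < n.+1 | ~~ (j < m)%N) w k j) / (L * p2).
  have -> : 1 - \sum_(j < n.+1 | ~~ (j < m)%N) w k j
      = \sum_(j < n.+1 | (j < m)%N) w k j.
    rewrite -(weight_sum QTQ AE (S_gt0 k)).
    by rewrite (bigID (fun j : 'I_n.+1 => (j < m)%N))/= addrK.
  have -> : S k * \sum_(j < n.+1 | (j < m)%N) w k j = P k ^+ 2 * (L * p2).
    rewrite /p2 !mulr_sumr; apply: eq_bigr => j jm.
    by rewrite -l_y_sq l_m// y_dominant// /y; ring.
  by rewrite mulfK// mulf_neq0 ?gt_eqF.
(* The limit is written in the shape of [PE], with a sum of zeros, so that convergence can be proved
   factor by factor. *)
have -> : (Num.sqrt L / (2 * Num.sqrt p2)) ^+ 2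
    = L ^+ 2 / 4 * (1 - \sum_(j < n.+1 | ~~ (j < m)%N) 0) / (L * p2).
  rewrite big1// subr0 expr_div_n exprMn.
  rewrite !sqr_sqrtr ?(ltW p2_gt0) ?(ltW L_gt0)//.
  by field; rewrite !gt_eqF.
under eq_fun do rewrite PE.
apply: cvgMr_tmp; apply: cvgM; first exact: energy_lim.
apply: cvgB; first exact: cvg_cst.
apply: cvg_big => [|j jm]; first exact: add_continuous.
apply: mu_weight_lim.2; have /andP[_ lL] := lam_bnd j.
by rewrite lt_neqAle lL andbT -lam_dominant.
Qed.

End Iterates.

Theorem theorem5p8 (R : realType) (n : nat) (A Q : 'M[R]_n.+1)
    (lam : 'rV[R]_n.+1) (m1 m2 : nat) (eps : R) (x : nat -> 'cV[R]_n.+1)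
    (hA : spectral A Q lam m1 m2)
    (heps : 0 < eps < 1)
    (hx0 : orthproj (dominant_space Q m1) (x 0%N) != 0)
    (hstep : forall k : nat, x k.+1 = sm_step A eps (x k))
    (hres : forall k : nat, sm_residual A (x k) != 0) :
  let p := orthproj (dominant_space Q m1) (x 0%N) in
  let q1 := (enorm p)^-1 *: p in
  (exists xs : 'cV[R]_n.+1,
     global_minimizer (sm_objective A) xs /\ x k @[k --> \oo] --> xs) /\
  x k @[k --> \oo] --> (Num.sqrt (lam ord0 ord0) / 2) *: q1.
Proof.
move=> p q1; set L := lam ord0 ord0; set t := _ *: q1.
have [_ psd QTQ AE mono pos zero [/andP[m10 m12] m2r] _ dom _] := hA.
have L_gt0 : 0 < L by rewrite pos// (leq_trans m10)// (leq_trans m12).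
have lam_bnd i : 0 <= lam ord0 i <= L.
  rewrite mono// andbT; case: (ltnP i (\rank A)) => hi; last by rewrite zero.
  exact/ltW/pos.
set p2 := \sum_(j < n.+1 | (j < m1)%N) ecoord Q (x 0%N) j ^+ 2.
have cp i : ecoord Q p i = if (i < m1)%N then ecoord Q (x 0%N) i else 0.
  by rewrite (coord_dominant_proj QTQ).
have ppE : dot p p = p2.
  rewrite (coord_dot QTQ) /p2 [RHS]big_mkcond/=; apply: eq_bigr => i _.
  by rewrite cp; case: ifP => _; rewrite ?mulr0 ?expr2.
have p2_gt0 : 0 < p2.
  rewrite lt_def -ppE dot_ge0 andbT.
  by apply/eqP => /dot_eq0 p0; move: hx0; rewrite -/p p0 eqxx.
have [i0 i0m xi0] :
    exists2 i0 : 'I_n.+1, (i0 < m1)%N & ecoord Q (x 0%N) i0 != 0.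
  apply: contrapT => h; move: p2_gt0; rewrite /p2 big1 ?ltxx// => i im.
  have [->|ne] := eqVneq (ecoord Q (x 0%N) i) 0; first by rewrite expr0n.
  by exfalso; apply: h; exists i.
(* As [p] has norm sqrt p2, this is the constant of [dominant_coord_lim]. *)
have tE i : ecoord Q t i = Num.sqrt L / (2 * Num.sqrt p2) * ecoord Q p i.
  rewrite /t /q1 !coordZ /enorm ppE; field.
  by rewrite sqrtr_eq0 -ltNge.
have lim : x k @[k --> \oo] --> t.
  apply: (cvg_coord QTQ) => i; rewrite tE cp; case: ifP => im.
    exact: (dominant_coord_lim QTQ AE L_gt0 lam_bnd dom heps hstep i0m xi0).
  rewrite mulr0; apply: (dominated_coord_lim QTQ AE L_gt0 lam_bnd dom heps
    hstep i0m xi0).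
  by rewrite im.
split=> //; exists t; split=> //.
have quad y : dot y (A *m y) = \sum_i lam ord0 i * ecoord Q y i ^+ 2.
  exact: coord_energy.
have ttE : dot t t = L / 4.
  have -> : dot t t = (Num.sqrt L / (2 * Num.sqrt p2)) ^+ 2 * dot p p.
    rewrite !(coord_dot QTQ) mulr_sumr; apply: eq_bigr => i _.
    by rewrite tE; ring.
  rewrite ppE expr_div_n exprMn !sqr_sqrtr ?(ltW p2_gt0) ?(ltW L_gt0)//.
  by field; rewrite gt_eqF.
apply: (objective_minimizer L_gt0) => // [y|].
  rewrite quad (coord_dot QTQ) mulr_sumr; apply: ler_sum => i _.
  by rewrite -expr2 ler_wpM2r ?sqr_ge0//; case/andP: (lam_bnd i).
(* All nonzero coordinates of [t] are dominant, so its energy is [L] times its squared norm. *)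
have -> : L ^+ 2 / 4 = L * (L / 4) by ring.
rewrite -ttE quad (coord_dot QTQ) mulr_sumr; apply: eq_bigr => i _.
rewrite tE cp; have := dom i; case: ifP => _; last first.
  by rewrite !mulr0 expr0n mulr0.
by move=> /esym/eqP ->; rewrite -expr2.
Qed.
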